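(* Let $p$ be an odd prime and let $n$ be even with $2\le n\le p-3$. Then, in $\mathbb Z_{(p)}[i]$, $$\mathbf G_n(p)\equiv p(p-1)(1+i^{\,n})B_n\pmod{p^2}.$$ In particular, if $n\equiv 2\pmod 4$ then $\mathbf G_n(p)\equiv 0\pmod{p^2}$, and if $n\equiv 0\pmod 4$ then $\mathbf G_n(p)\equiv 2p(p-1)B_n\pmod{p^2}$.
   Context: Here $i^2=-1$. For an odd prime $p$ and $n\ge 0$, $\mathbf G_n(p)=\sum_{a=1}^{p-1}\sum_{b=1}^{p-1}(a+bi)^n\in\mathbb Z[i]$. $B_n$ denotes the $n$-th Bernoulli number, $\frac{z}{e^z-1}=\sum_{n\ge0}B_n\frac{z^n}{n!}$. $\mathbb Z_{(p)}$ is the localization of $\mathbb Z$ at $(p)$; $x\equiv y\pmod{p^k}$ means $x-y\in p^k\mathbb Z_{(p)}[i]$. *)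

(* Defs.v *)
From HB Require Import structures.
From mathcomp Require Import all_boot all_order all_algebra all_field.

Set Implicit Arguments.
Unset Strict Implicit.
Unset Printing Implicit Defensive.

Import Order.TTheory GRing.Theory Num.Theory.
Local Open Scope ring_scope.

(* A formal power series over the rationals is its sequence of coefficients. *)
Definition fps := nat -> rat.

Definition fps_mul (f g : fps) : fps :=
  fun n => \sum_(k < n.+1) f k * g (n - k)%N.

(* The inverse g of f is determined by f 0 * g 0 = 1 and, for n > 0, by       *)
(* \sum_(k <= n) g k * f (n - k) = 0; the list holds g 0, ..., g (n - 1).     *)
Fixpoint fps_inv_prefix (f : fps) (n : nat) : seq rat :=
  if n is m.+1 then
    let s := fps_inv_prefix f m in
    rcons s (((m == 0)%N%:R - \sum_(k < m) s`_k * f (m - k)%N) / f 0%N)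
  else [::].

Definition fps_inv (f : fps) : fps := fun n => (fps_inv_prefix f n.+1)`_n.

(* e^z - 1 *)
Definition expm1 : fps := fun n => if n is 0 then 0 else (n`!)%:R^-1.

(* z / (e^z - 1), as the inverse of the series (e^z - 1) / z. *)
Definition bernoulli_series : fps := fps_inv (fun n => expm1 n.+1).

Definition bernoulli (n : nat) : rat := (n`!)%:R * bernoulli_series n.

Lemma size_fps_inv_prefix (f : fps) n : size (fps_inv_prefix f n) = n.
Proof. by elim: n => //= n IHn; rewrite size_rcons IHn. Qed.

Lemma nth_fps_inv_prefix (f : fps) n k :
  (k < n)%N -> (fps_inv_prefix f n)`_k = fps_inv f k.
Proof.
elim: n => // n IHn; rewrite ltnS leq_eqVlt => /orP[/eqP-> //|ltkn].
by rewrite /= nth_rcons size_fps_inv_prefix ltkn IHn.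
Qed.

Lemma fps_mulVf (f : fps) n :
  f 0%N != 0 -> fps_mul (fps_inv f) f n = (n == 0)%N%:R.
Proof.
move=> f0; rewrite /fps_mul big_ord_recr /= subnn.
rewrite {2}/fps_inv /= nth_rcons size_fps_inv_prefix ltnn eqxx divfK //.
rewrite addrC -addrA (eq_bigr (fun k : 'I_n => fps_inv f k * f (n - k)%N)).
  by rewrite addNr addr0.
by move=> k _; rewrite nth_fps_inv_prefix.
Qed.

(* The generating function: (\sum_n B_n z^n / n!) (e^z - 1) = z. *)
Lemma bernoulli_egf n :
  fps_mul (fun k => bernoulli k / (k`!)%:R) expm1 n = (n == 1)%N%:R.
Proof.
case: n => [|n]; first by rewrite /fps_mul big_ord_recr big_ord0 /= mulr0 addr0.
rewrite /fps_mul big_ord_recr /= subnn mulr0 addr0.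
have e0 : expm1 1 != 0 by rewrite /expm1 invr_eq0 pnatr_eq0.
rewrite eqSS -(@fps_mulVf (fun m => expm1 m.+1) n e0) /fps_mul.
apply: eq_bigr => k _; rewrite (@subSn k n) -1?ltnS //; congr (_ * _).
rewrite /bernoulli -/bernoulli_series; move: (bernoulli_series k) => c.
by rewrite mulrAC divff ?mul1r // pnatr_eq0 -lt0n fact_gt0.
Qed.

(* Z_(p), as the fractions a / s with s prime to p. *)
Definition in_Zloc (p : nat) (u : rat) : Prop :=
  exists a s : int, ~~ (p%:Z %| s)%Z /\ u = a%:~R / s%:~R.

(* Z_(p)[i], inside the algebraic numbers. *)
Definition in_Zloc_i (p : nat) (x : algC) : Prop :=
  exists u v : rat, [/\ in_Zloc p u, in_Zloc p v & x = ratr u + ratr v * 'i].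

(* x = y modulo p ^ k Z_(p)[i] *)
Definition congr_Zloc_i (p k : nat) (x y : algC) : Prop :=
  exists2 w : algC, in_Zloc_i p w & x - y = p%:R ^+ k * w.

Definition gauss_power_sum (p n : nat) : algC :=
  \sum_(1 <= a < p) \sum_(1 <= b < p) (a%:R + b%:R * 'i) ^+ n.

(* Main.v *)
Require Import Defs.
From HB Require Import structures.
From mathcomp Require Import all_boot all_order all_algebra all_field.
From mathcomp Require Import ring.

Set Implicit Arguments.
Unset Strict Implicit.
Unset Printing Implicit Defensive.

Import Order.TTheory GRing.Theory Num.Theory.
Local Open Scope ring_scope.

(** Write S_k for the sum of a ^ k over 0 <= a < p. Telescoping
    (a + 1) ^ m - a ^ m gives, for m > 0, the triangular system
      \sum_(j < m) 'C(m, j) S_j = p ^ m,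
    while the generating function of the Bernoulli numbers gives
      \sum_(j < m) 'C(m, j) B_j = [m = 1].
    The diagonal entry of row m is m, a unit of Z_(p) as long as m < p, so that
    [bernoulli_system_integral] transfers integrality from the right-hand side
    of such a system to its solution. Applied to B_j it shows that B_j is
    p-integral for j <= p - 2. Applied to (S_j - p B_j) / p ^ 2, whose row m has
    right-hand side (p ^ m - p [m = 1]) / p ^ 2, equal to 0 for m = 1 and to
    p ^ (m - 2) for m >= 2, it shows that S_j = p B_j modulo p ^ 2. In
    particular p divides S_j.

    Expanding (a + b i) ^ n by the binomial formula, G_n(p) is the sum of
    'C(n, k) i ^ k S_(n-k) S_k, with the zeroth power sum replaced by p - 1
    because a and b start from 1. For 0 < k < n both power sums are divisible
    by p, so only k = 0 and k = n survive modulo p ^ 2, and they contribute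
    (p - 1) (1 + i ^ n) S_n, that is p (p - 1) (1 + i ^ n) B_n. *)

(** * The ring Z_(p) and its extension by i *)

Lemma in_Zloc_int p (z : int) : prime p -> in_Zloc p z%:~R.
Proof.
move=> pp; exists z, 1; split; last by rewrite divr1.
by rewrite dvdzE /= dvdn1 neq_ltn prime_gt1 ?orbT.
Qed.

Lemma in_Zloc_nat p m : prime p -> in_Zloc p m%:R.
Proof. by move=> pp; rewrite -[m%:R]/(m%:Z%:~R); apply: in_Zloc_int. Qed.

Lemma dvdz_prime_mul p (s t : int) : prime p ->
  ~~ (p%:Z %| s)%Z -> ~~ (p%:Z %| t)%Z -> ~~ (p%:Z %| s * t)%Z.
Proof. by move=> pp; rewrite !dvdzE abszM Euclid_dvdM // negb_or => -> ->. Qed.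

Lemma ndvdz_neq0 p (s : int) : ~~ (p%:Z %| s)%Z -> s%:~R != 0 :> rat.
Proof. by rewrite intr_eq0; apply: contraNneq => ->; rewrite dvdz0. Qed.

Lemma in_ZlocD p u v : prime p -> in_Zloc p u -> in_Zloc p v ->
  in_Zloc p (u + v).
Proof.
move=> pp [a [s [Hs ->]]] [b [t [Ht ->]]].
exists (a * t + b * s), (s * t); split; first exact: dvdz_prime_mul.
by rewrite rmorphD !rmorphM addf_div ?(ndvdz_neq0 Hs) ?(ndvdz_neq0 Ht).
Qed.

Lemma in_ZlocM p u v : prime p -> in_Zloc p u -> in_Zloc p v ->
  in_Zloc p (u * v).
Proof.
move=> pp [a [s [Hs ->]]] [b [t [Ht ->]]].
exists (a * b), (s * t); split; first exact: dvdz_prime_mul.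
by rewrite !rmorphM mulf_div.
Qed.

Lemma in_ZlocN p u : in_Zloc p u -> in_Zloc p (- u).
Proof.
by case=> a [s [Hs ->]]; exists (- a), s; split; rewrite // rmorphN mulNr.
Qed.

Lemma in_ZlocV p m : (0 < m < p)%N -> in_Zloc p m%:R^-1.
Proof.
case/andP=> m_gt0 ltmp; exists 1, m%:Z; split; last by rewrite mul1r.
by rewrite dvdzE /= gtnNdvd.
Qed.

Lemma in_Zloc_sum p I (r : seq I) (P : pred I) (F : I -> rat) : prime p ->
  (forall i, P i -> in_Zloc p (F i)) -> in_Zloc p (\sum_(i <- r | P i) F i).
Proof.
move=> pp HF; apply: big_ind => //; first exact: (in_Zloc_nat 0 pp).
by move=> u v; apply: in_ZlocD.
Qed.

Lemma in_Zloc_i_ratr p u : prime p -> in_Zloc p u -> in_Zloc_i p (ratr u).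
Proof.
move=> pp Hu; exists u, 0; split=> //; first exact: (in_Zloc_nat 0 pp).
by rewrite rmorph0 mul0r addr0.
Qed.

Lemma in_Zloc_i_nat p m : prime p -> in_Zloc_i p m%:R.
Proof.
by move=> pp; rewrite -(ratr_nat _ m); apply/in_Zloc_i_ratr/in_Zloc_nat.
Qed.

Lemma in_Zloc_i_imaginary p : prime p -> in_Zloc_i p 'i.
Proof.
move=> pp; exists 0, 1; split; first exact: (in_Zloc_nat 0 pp).
  exact: (in_Zloc_nat 1 pp).
by rewrite rmorph0 rmorph1 mul1r add0r.
Qed.

Lemma in_Zloc_iD p x y : prime p -> in_Zloc_i p x -> in_Zloc_i p y ->
  in_Zloc_i p (x + y).
Proof.
move=> pp [u [v [Hu Hv ->]]] [u' [v' [Hu' Hv' ->]]].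
exists (u + u'), (v + v'); split; [exact: in_ZlocD | exact: in_ZlocD |].
by rewrite !rmorphD /=; ring.
Qed.

Lemma in_Zloc_iM p x y : prime p -> in_Zloc_i p x -> in_Zloc_i p y ->
  in_Zloc_i p (x * y).
Proof.
move=> pp [u [v [Hu Hv ->]]] [u' [v' [Hu' Hv' ->]]].
exists (u * u' - v * v'), (u * v' + v * u'); split.
- by apply: in_ZlocD => //; [|apply: in_ZlocN]; apply: in_ZlocM.
- by apply: in_ZlocD => //; apply: in_ZlocM.
rewrite rmorphB rmorphD !rmorphM /=.
have := sqrCi algC; rewrite expr2 => ii.
rewrite [LHS](_ : _ = ratr u * ratr u' +
  (ratr u * ratr v' + ratr v * ratr u') * 'i + ratr v * ratr v' * ('i * 'i)).
  by rewrite ii; ring.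
by ring.
Qed.

Lemma in_Zloc_iX p x k : prime p -> in_Zloc_i p x -> in_Zloc_i p (x ^+ k).
Proof.
move=> pp Hx; elim: k => [|k IHk]; first exact: (in_Zloc_i_nat 1 pp).
by rewrite exprS; apply: in_Zloc_iM.
Qed.

(** * Bernoulli numbers and power sums modulo p ^ 2 *)

(** This is m! times the coefficient of z ^ m in
    (\sum_j B_j z ^ j / j!) (e ^ z - 1) = z. *)
Lemma bernoulli_rec m :
  \sum_(j < m) 'C(m, j)%:R * bernoulli j = (m == 1)%N%:R.
Proof.
transitivity (m`!%:R * ((m == 1)%N%:R : rat)); last first.
  by case: eqP => [->|]; rewrite ?mulr1 ?mulr0.
rewrite -bernoulli_egf /fps_mul big_ord_recr /= subnn mulr0 addr0 mulr_sumr.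
apply: eq_bigr => -[j ltjm] _ /=.
have -> : expm1 (m - j)%N = (m - j)`!%:R^-1.
  by rewrite /expm1; case: (m - j)%N (subn_gt0 j m) => //; rewrite ltjm.
rewrite -(bin_fact (ltnW ltjm)) !natrM.
have jf : (j`!)%:R != 0 :> rat by rewrite pnatr_eq0 -lt0n fact_gt0.
have mjf : ((m - j)`!)%:R != 0 :> rat by rewrite pnatr_eq0 -lt0n fact_gt0.
by field; rewrite jf mjf.
Qed.

(** The term a = 0 is included, with 0 ^ 0 = 1, so that the recurrence below
    telescopes from 0 to N ^ m without a boundary term. *)
Definition power_sum (N j : nat) : rat := \sum_(a < N) a%:R ^+ j.

(** Each a < N contributes (a + 1) ^ m - a ^ m to the left-hand side, by the
    binomial formula; for m = 0 it would be 0 instead of 1. *)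
Lemma power_sum_rec N m : (0 < m)%N ->
  \sum_(j < m) 'C(m, j)%:R * power_sum N j = N%:R ^+ m.
Proof.
move=> m_gt0; elim: N => [|N IHN].
  rewrite expr0n gtn_eqF // big1 // => j _.
  by rewrite /power_sum big_ord0 mulr0.
rewrite -natr1 [in RHS]addrC exprDn big_ord_recr /= subnn expr0 mul1r binn.
rewrite mulr1n -IHN [RHS]addrC -big_split /=; apply: eq_bigr => j _.
by rewrite /power_sum big_ord_recr /= mulrDr expr1n mul1r !mulr_natl.
Qed.

(** Row n of the system has diagonal entry n + 1, invertible in Z_(p) when
    n + 1 < p, so the unknowns can be solved for one after the other. *)
Lemma bernoulli_system_integral p (d : nat -> rat) : prime p ->
  (forall n, (n.+1 < p)%N ->
     in_Zloc p (\sum_(j < n.+1) 'C(n.+1, j)%:R * d j)) ->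
  forall n, (n.+1 < p)%N -> in_Zloc p (d n).
Proof.
move=> pp Hsys; elim/ltn_ind => n IHn ltnp.
have := Hsys n ltnp; rewrite big_ord_recr /= binSn.
set s := \sum_(_ < _) _ => Hrow.
have -> : d n = n.+1%:R^-1 * ((s + n.+1%:R * d n) - s).
  by rewrite addrAC subrr add0r mulKf // pnatr_eq0.
apply: in_ZlocM => //; first exact: in_ZlocV.
apply: in_ZlocD => //; apply: in_ZlocN; apply: in_Zloc_sum => // j _.
apply: in_ZlocM => //; first exact: in_Zloc_nat.
exact/IHn/(leq_ltn_trans (ltn_ord j))/ltnW.
Qed.

Lemma bernoulli_integral p n : prime p -> (n.+1 < p)%N ->
  in_Zloc p (bernoulli n).
Proof.
move=> pp; apply: (@bernoulli_system_integral p bernoulli) => // m _.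
by rewrite bernoulli_rec; apply: in_Zloc_nat.
Qed.

(** S_j and p B_j solve triangular systems with the same matrix, whose
    right-hand sides agree modulo p ^ 2. *)
Lemma power_sum_bernoulli p n : prime p -> (n.+1 < p)%N ->
  exists2 z, in_Zloc p z & power_sum p n = p%:R * bernoulli n + p%:R ^+ 2 * z.
Proof.
move=> pp ltnp; have p0 : p%:R != 0 :> rat by rewrite pnatr_eq0 -lt0n prime_gt0.
pose d j := (power_sum p j - p%:R * bernoulli j) / p%:R ^+ 2.
exists (d n); last by rewrite /d; field.
apply: (@bernoulli_system_integral p d) => // m _.
rewrite [X in in_Zloc p X](_ : _ =
    (p%:R ^+ m.+1 - p%:R * (m == 0)%N%:R) / p%:R ^+ 2).
  case: m => [|m].
    by rewrite mulr1 subrr mul0r; exact: (in_Zloc_nat 0 pp).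
  rewrite mulr0 subr0 -addn2 exprD mulfK ?expf_neq0 // -natrX.
  exact: in_Zloc_nat.
rewrite -(power_sum_rec p (ltn0Sn m)) -eqSS -(bernoulli_rec m.+1).
rewrite mulr_sumr -sumrB mulr_suml; apply: eq_bigr => j _.
by rewrite /d; field.
Qed.

Lemma power_sum_dvd p n : prime p -> (n.+1 < p)%N ->
  exists2 z, in_Zloc p z & power_sum p n = p%:R * z.
Proof.
move=> pp ltnp; have [z Hz ->] := power_sum_bernoulli pp ltnp.
exists (bernoulli n + p%:R * z); last by ring.
apply: in_ZlocD => //; first exact: bernoulli_integral.
by apply: in_ZlocM => //; apply: in_Zloc_nat.
Qed.

(** * The double sum over Gaussian integers *)

(** Over a >= 1 the zeroth power sum is p - 1 instead of p; for positive
    exponents the term a = 0 vanishes. *)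
Lemma power_sum_from1 p k : (0 < k)%N ->
  \sum_(1 <= a < p) a%:R ^+ k = ratr (power_sum p k) :> algC.
Proof.
move=> k_gt0; rewrite /power_sum rmorph_sum /=; case: p => [|p].
  by rewrite big_ord0 big_geq.
rewrite big_ord_recl rmorphXn rmorph0 expr0n gtn_eqF // add0r.
rewrite big_add1 big_mkord; apply: eq_bigr => i _.
by rewrite rmorphXn /= ratr_nat.
Qed.

Lemma gauss_power_sum_binomial p n :
  gauss_power_sum p n =
  \sum_(k < n.+1) 'C(n, k)%:R * 'i ^+ k *
    ((\sum_(1 <= a < p) a%:R ^+ (n - k)) * (\sum_(1 <= b < p) b%:R ^+ k)).
Proof.
rewrite /gauss_power_sum.
under eq_bigr => a _ do under eq_bigr => b _ do rewrite exprDn.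
under eq_bigr => a _ do rewrite exchange_big.
rewrite exchange_big; apply: eq_bigr => k _ /=.
rewrite mulr_suml mulr_sumr; apply: eq_bigr => a _.
rewrite !mulr_sumr; apply: eq_bigr => b _.
by rewrite exprMn -mulr_natr; ring.
Qed.

Lemma gauss_power_sum_congr p n : prime p -> (0 < n)%N -> (n.+1 < p)%N ->
  congr_Zloc_i p 2 (gauss_power_sum p n)
    (p%:R * (p%:R - 1) * (1 + 'i ^+ n) * ratr (bernoulli n)).
Proof.
move=> pp n_gt0 ltnp.
have S0 : \sum_(1 <= a < p) a%:R ^+ 0 = p.-1%:R :> algC.
  under eq_bigr => a _ do rewrite expr0.
  by rewrite sumr_const_nat subn1.
have [z Hz Sn] := power_sum_bernoulli pp ltnp.
(* For 0 < k < n the power sums of exponents k and n - k are both divisible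
   by p. *)
have [w Hw middle] : exists2 w : algC, in_Zloc_i p w &
    \sum_(1 <= k < n) 'C(n, k)%:R * 'i ^+ k *
      ((\sum_(1 <= a < p) a%:R ^+ (n - k)) * (\sum_(1 <= b < p) b%:R ^+ k))
    = p%:R ^+ 2 * w.
  rewrite big_nat.
  apply: (big_ind (fun x => exists2 w, in_Zloc_i p w & x = p%:R ^+ 2 * w)).
  - by exists 0; [exact: (in_Zloc_i_nat 0 pp) | rewrite mulr0].
  - move=> _ _ [x Hx ->] [y Hy ->].
    by exists (x + y); [apply: in_Zloc_iD | rewrite mulrDr].
  move=> k /andP[k_gt0 ltkn].
  have [] := @power_sum_dvd p k pp; first by apply: ltn_trans ltnp.
  move=> x Hx Sk.
  have [] := @power_sum_dvd p (n - k) pp.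
    by apply: leq_ltn_trans ltnp; rewrite ltnS leq_subr.
  move=> y Hy Snk.
  exists ('C(n, k)%:R * 'i ^+ k * (ratr y * ratr x)).
    apply: in_Zloc_iM => //.
      apply: in_Zloc_iM; rewrite //; first exact: in_Zloc_i_nat.
      exact/in_Zloc_iX/in_Zloc_i_imaginary.
    by apply: in_Zloc_iM => //; apply: in_Zloc_i_ratr.
  rewrite !power_sum_from1 ?subn_gt0 // Sk Snk !rmorphM /= ratr_nat; ring.
(* What is left are k = 0 and k = n, where S_n = p B_n + p ^ 2 z. *)
exists (w + p.-1%:R * (1 + 'i ^+ n) * ratr z).
  apply: in_Zloc_iD => //; apply: in_Zloc_iM; rewrite //; last first.
    exact: in_Zloc_i_ratr.
  apply: in_Zloc_iM; rewrite //; first exact: in_Zloc_i_nat.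
  apply: in_Zloc_iD; rewrite //; first exact: (in_Zloc_i_nat 1 pp).
  exact/in_Zloc_iX/in_Zloc_i_imaginary.
rewrite [RHS]mulrDr -middle gauss_power_sum_binomial.
rewrite -(big_mkord predT (fun k => 'C(n, k)%:R * 'i ^+ k *
    ((\sum_(1 <= a < p) a%:R ^+ (n - k)) * (\sum_(1 <= b < p) b%:R ^+ k)))).
rewrite big_nat_recr //= big_ltn //= subnn subn0 bin0 binn S0.
rewrite power_sum_from1 // Sn rmorphD !rmorphM /= ratr_nat.
have -> : p%:R - 1 = p.-1%:R :> algC by rewrite -subn1 natrB ?prime_gt0.
ring.
Qed.

Theorem corollary2 (p n : nat) (p_prime : prime p) (p_odd : odd p)
    (n_even : ~~ odd n) (n_bounds : (2 <= n <= p - 3)%N) :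
  [/\ congr_Zloc_i p 2 (gauss_power_sum p n)
        (p%:R * (p%:R - 1) * (1 + 'i ^+ n) * ratr (bernoulli n)),
      (n = 2 %[mod 4])%N -> congr_Zloc_i p 2 (gauss_power_sum p n) 0
    & (n = 0 %[mod 4])%N ->
        congr_Zloc_i p 2 (gauss_power_sum p n)
          (2 * p%:R * (p%:R - 1) * ratr (bernoulli n))].
Proof.
case/andP: n_bounds => n_ge2 n_le.
have ltnp : (n.+1 < p)%N.
  have p_gt3 : (3 < p)%N.
    by rewrite -subn_gt0; exact: leq_trans (ltnW n_ge2) n_le.
  by rewrite -(subnK (ltnW p_gt3)) addn3 !ltnS (leq_trans n_le (leqnSn _)).
have main := gauss_power_sum_congr p_prime (ltnW n_ge2) ltnp.
have i2 := sqrCi algC.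
have i4 : 'i ^+ 4 = 1 :> algC by rewrite (exprM _ 2 2) i2 sqrrN expr1n.
split=> //.
  move=> n2; move: main; rewrite -[X in 1 + X](expr_mod _ i4) n2 i2.
  by rewrite subrr mulr0 mul0r.
move=> n0; move: main; rewrite -[X in 1 + X](expr_mod _ i4) n0 expr0.
rewrite (_ : p%:R * _ * _ * _ = 2 * p%:R * (p%:R - 1) * ratr (bernoulli n)) //.
by ring.
Qed.
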